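(* Let $\hat F$ be a regular admissible extended frame on a domain $\Omega\subset\mathbb R^2$, $F=\hat F|_{\lambda=1}$, and for $\mu\in\mathbb R$, $\mu\ne0,1$, let $f^\mu=\hat F|_{\lambda=\mu}\hat F|_{\lambda=1}^{-1}$ and let $N^\mu=\hat F|_{\lambda=\mu}\,e_3\,\hat F|_{\lambda=1}^{-1}=f^\mu\,\mathrm{Ad}_Fe_3$ be its unit normal. Then for every $\theta\in\mathbb R$, $$f^\mu\cosh\theta+N^\mu\sinh\theta=\hat F|_{\lambda=\mu}\;\exp(\theta e_3)\;\hat F|_{\lambda=1}^{-1}.$$
   Context: Put $e_3=\begin{pmatrix}-1&0\\0&1\end{pmatrix}$, $\xi_1=\begin{pmatrix}0&0\\1&0\end{pmatrix}$, $\xi_2=\begin{pmatrix}0&1\\0&0\end{pmatrix}$, $\mathrm{Ad}_FX=FXF^{-1}$. All maps are smooth. An admissible extended frame on $\Omega$ is a family of maps $\hat F|_\lambda:\Omega\to SL(2,\mathbb R)$, depending smoothly on $\lambda\in\mathbb R\setminus\{0\}$ (i.e. a map into the loop group $\Lambda SL(2,\mathbb R)$), with $$\hat F^{-1}d\hat F=(\lambda A^1\xi_1+A^2\xi_2+A^3e_3)\,dx+(B^1\xi_1+\lambda^{-1}B^2\xi_2+B^3e_3)\,dy,$$ where $A^i,B^i$ are real functions of $(x,y)$ independent of $\lambda$. It is regular if $A^1\ne0$ and $B^2\ne0$ everywhere on $\Omega$. The map $f^\mu$ is a timelike immersion into anti-de Sitter space $\mathbb H^3_1=SL(2,\mathbb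 R)$, for the metric induced from $\langle X,X\rangle=-\det X$ on $2\times 2$ real matrices, with unit normal $N^\mu$. *)

(* Defs.v *)
From HB Require Import structures.
From mathcomp Require Import all_boot all_order all_algebra.
From mathcomp Require Import all_classical all_reals all_analysis.
Set Implicit Arguments.
Unset Strict Implicit.
Unset Printing Implicit Defensive.
Import Order.TTheory GRing.Theory Num.Theory.
Import numFieldNormedType.Exports.
Local Open Scope classical_set_scope.
Local Open Scope ring_scope.

Section Defs.
Context {R : realType}.
Implicit Types (Omega : set (R * R)) (p v w : R * R).

Definition cosh (t : R) : R := (expR t + expR (- t)) / 2.
Definition sinh (t : R) : R := (expR t - expR (- t)) / 2.

Definition mexp (X : 'M[R]_2) : 'M[R]_2 :=
  limn (series (fun k => (k`!%:R)^-1 *: X ^+ k)).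

Definition mx2 (a b c d : R) : 'M[R]_2 :=
  \matrix_(i < 2, j < 2)
    if i == ord0 then if j == ord0 then a else b
    else if j == ord0 then c else d.

Definition e3 : 'M[R]_2 := mx2 (-1) 0 0 1.
Definition xi1 : 'M[R]_2 := mx2 0 0 1 0.
Definition xi2 : 'M[R]_2 := mx2 0 1 0 0.

Definition Ad (F X : 'M[R]_2) : 'M[R]_2 := F *m X *m invmx F.

Definition SL2 : set 'M[R]_2 := [set X | \det X = 1].

(* The symmetric bilinear form obtained by polarization from
   <X, X> = - \det X. *)
Definition mform (X Y : 'M[R]_2) : R :=
  (\det X + \det Y - \det (X + Y)) / 2.

(* C^k on a set U, meant for U open and V finite-dimensional; the base case is
   k = 0, continuity, and the step uses all directional derivatives. *)
Fixpoint Ck (V W : normedModType R) (k : nat) (U : set V) (f : V -> W) : Prop :=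
  if k is k'.+1 then
    (forall x, U x -> differentiable f x) /\
    (forall v : V, Ck k' U (fun x => 'D_v f x))
  else forall x, U x -> {for x, continuous f}.

Definition smooth_on (V W : normedModType R) (U : set V) (f : V -> W) : Prop :=
  forall k, Ck k U f.

Definition planar_domain Omega : Prop :=
  [/\ open Omega, connected Omega & Omega !=set0].

(* The value at the tangent vector v of the one-form F^-1 dF. *)
Definition maurer_cartan (F : R * R -> 'M[R]_2) p v : 'M[R]_2 :=
  invmx (F p) *m ('d F p : R * R -> 'M[R]_2) v.

(* [Fhat l] is the map written \hat F|_lambda; its values at l = 0 are
   irrelevant.  A map into the loop group is smooth when it is smooth jointly
   in lambda and the point.  The one-form equation is tested on tangent vectors
   v, for which dx v = v.1 and dy v = v.2. *)
Definition admissible_extended_frame Omega (Fhat : R -> R * R -> 'M[R]_2)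
    (A1 A2 A3 B1 B2 B3 : R * R -> R) : Prop :=
  [/\ forall l p, l != 0 -> Omega p -> SL2 (Fhat l p),
      smooth_on [set u : R * (R * R) | u.1 != 0 /\ Omega u.2]
        (fun u => Fhat u.1 u.2),
      [/\ smooth_on Omega A1, smooth_on Omega A2 & smooth_on Omega A3],
      [/\ smooth_on Omega B1, smooth_on Omega B2 & smooth_on Omega B3] &
      forall l p v, l != 0 -> Omega p ->
        maurer_cartan (Fhat l) p v =
          v.1 *: ((l * A1 p) *: xi1 + A2 p *: xi2 + A3 p *: e3) +
          v.2 *: (B1 p *: xi1 + (l^-1 * B2 p) *: xi2 + B3 p *: e3)].

Definition regular_frame Omega (A1 B2 : R * R -> R) : Prop :=
  forall p, Omega p -> A1 p != 0 /\ B2 p != 0.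

Definition frame_map (Fhat : R -> R * R -> 'M[R]_2) (mu : R) p : 'M[R]_2 :=
  Fhat mu p *m invmx (Fhat 1 p).

Definition frame_normal (Fhat : R -> R * R -> 'M[R]_2) (mu : R) p : 'M[R]_2 :=
  Fhat mu p *m e3 *m invmx (Fhat 1 p).

Definition induced_metric (f : R * R -> 'M[R]_2) p v w : R :=
  mform (('d f p : R * R -> 'M[R]_2) v) (('d f p : R * R -> 'M[R]_2) w).

Definition lorentzian (g : R * R -> R * R -> R) : Prop :=
  exists v w, [/\ g v v = -1, g w w = 1 & g v w = 0].

Definition timelike_immersion Omega (f : R * R -> 'M[R]_2) : Prop :=
  smooth_on Omega f /\
  forall p, Omega p ->
    [/\ SL2 (f p), injective ('d f p : R * R -> 'M[R]_2) &
        lorentzian (induced_metric f p)].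

(* N p is tangent to SL(2, R) at f p exactly when it is orthogonal to f p,
   since SL(2, R) is the level set <X, X> = -1. *)
Definition unit_normal Omega (f N : R * R -> 'M[R]_2) : Prop :=
  smooth_on Omega N /\
  forall p, Omega p ->
    [/\ mform (N p) (f p) = 0,
        forall v, mform (N p) (('d f p : R * R -> 'M[R]_2) v) = 0 &
        mform (N p) (N p) = 1].

End Defs.

(* Main.v *)
(* The inverse of a 2x2 matrix X of determinant 1 is its adjugate (tr X) I - X,
   which is linear in X, so f := F_mu F_1^-1 and F_mu e3 F_1^-1 are bilinear in
   the smooth maps F_mu and F_1.  If alpha_l denotes F_l^-1 dF_l, the product
   rule gives df = F_mu (alpha_mu - alpha_1) F_1^-1, and in the difference only
   the terms depending on lambda survive:
     alpha_mu - alpha_1 = (mu - 1) A1 dx xi1 + (mu^-1 - 1) B2 dy xi2.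
   Since X |-> F_mu X F_1^-1 is an isometry, everything reduces to constant
   matrices: the induced metric is (mu - 1)(mu^-1 - 1) A1 B2 dx dy, and e3 is of
   norm 1 and orthogonal to the identity, xi1 and xi2.  Finally exp (theta e3) is
   diag (e^-theta, e^theta) = cosh theta I + sinh theta e3. *)
Require Import Defs.
From HB Require Import structures.
From mathcomp Require Import all_boot all_order all_algebra.
From mathcomp Require Import all_classical all_reals all_analysis.
From mathcomp Require Import ring.
Set Implicit Arguments.
Unset Strict Implicit.
Unset Printing Implicit Defensive.
Import Order.TTheory GRing.Theory Num.Theory.
Import numFieldNormedType.Exports.
Local Open Scope classical_set_scope.
Local Open Scope ring_scope.

(** * Calculus of $C^k$ maps on open sets *)

Lemma near_eq_diff (R : realType) (V W : normedModType R) (f g : V -> W)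
    (x : V) :
  {near x, f =1 g} -> differentiable f x ->
  differentiable g x /\ 'd g x = 'd f x :> (V -> W).
Proof.
move=> fg df.
(* The first-order expansion of [f] at [x] involves only values near [x], so it is also one of [g];
   uniqueness of the differential then gives [dgE]. *)
have eqg : g \o shift x = cst (g x) + 'd f x +o_ 0 id.
  apply/eqaddoP => e e0.
  have /eqaddoP/(_ e e0) h : f \o shift x = cst (f x) + 'd f x +o_ 0 id.
    by case/diff_locallyP : df.
  have fg0 : \forall h \near (0 : V), f (h + x) = g (h + x).
    by have /nbhs0P := fg; apply: filterS => v; rewrite addrC.
  apply: filterS2 h fg0 => v /=; rewrite !fctE => + <-.
  by rewrite (nbhs_singleton fg).
have dgE : 'd g x = 'd f x :> (V -> W).
  by apply: diff_unique => //; exact: diff_continuous.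
split=> //; apply/diff_locallyP; rewrite dgE; split=> //.
exact: diff_continuous.
Qed.

(** Since [U] is open, equality on [U] is equality near each of its points and so passes to
    derivatives of every order. *)
Lemma eq_Ck (R : realType) (V W : normedModType R) k (U : set V)
    (f g : V -> W) :
  open U -> (forall x, U x -> f x = g x) -> Ck k U f -> Ck k U g.
Proof.
move=> Uo; elim: k f g => [|k IH] f g fg.
  move=> /= fc x Ux.
  have nfg : \forall y \near x, f y = g y.
    by apply: filterS (open_nbhs_nbhs (conj Uo Ux)) => y /fg.
  suff : g @ x --> f x by rewrite (fg x Ux).
  by apply: cvg_trans (fc x Ux); apply: near_eq_cvg.
have nfg x : U x -> \forall y \near x, f y = g y.
  by move=> Ux; apply: filterS (open_nbhs_nbhs (conj Uo Ux)) => y /fg.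
move=> [df Df]; split=> [x Ux|v].
  exact: (proj1 (near_eq_diff (nfg x Ux) (df x Ux))).
by apply: IH (Df v) => x Ux; exact: near_eq_derive (nfg x Ux).
Qed.

Lemma CkW (R : realType) (V W : normedModType R) k (U : set V) (f : V -> W) :
  Ck k.+1 U f -> Ck k U f.
Proof.
elim: k f => [f [df _] x Ux|k IH f [df Df]].
  exact/differentiable_continuous/df.
by split=> // v; exact/IH/Df.
Qed.

Lemma CkD (R : realType) (V W : normedModType R) k (U : set V) (f g : V -> W) :
  open U -> Ck k U f -> Ck k U g -> Ck k U (fun x => f x + g x).
Proof.
move=> Uo; elim: k f g => [f g fc gc x Ux|k IH f g [df Df] [dg Dg]].
  by apply: cvgD; [exact: fc | exact: gc].
split=> [x Ux|v]; first exact: differentiableD (df x Ux) (dg x Ux).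
apply: eq_Ck (IH _ _ (Df v) (Dg v)) => // x Ux; apply/esym/deriveD.
  exact/diff_derivable/df.
exact/diff_derivable/dg.
Qed.

Lemma Ck_linear (R : realType) (V W W' : normedModType R) k (U : set V)
    (L : {linear W -> W'}) (f : V -> W) :
  open U -> continuous L -> Ck k U f -> Ck k U (fun x => L (f x)).
Proof.
move=> Uo Lc; elim: k f => [f fc x Ux|k IH f [df Df]].
  exact: continuous_comp (fc x Ux) (Lc _).
have dLf x : U x -> differentiable (L \o f) x.
  move=> Ux; apply: (differentiable_comp (df x Ux)).
  exact: linear_differentiable.
split=> // v; apply: eq_Ck (IH _ (Df v)) => // x Ux.
have dL : differentiable L (f x) by exact: linear_differentiable.
rewrite (deriveE v (df x Ux)) [RHS](deriveE v (dLf x Ux)).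
by rewrite (diff_comp (df x Ux) dL) /= (diff_lin _ Lc).
Qed.

Lemma diff_bilin_comp (R : realType) (V W1 W2 W : normedModType R)
    (b : {bilinear W1 -> W2 -> W}) (f : V -> W1) (g : V -> W2) x :
  continuous (fun q => b q.1 q.2) -> differentiable f x -> differentiable g x ->
  differentiable (fun y => b (f y) (g y)) x /\
  'd (fun y => b (f y) (g y)) x =
    (fun v => b (f x) ('d g x v) + b ('d f x v) (g x)) :> (V -> W).
Proof.
move=> bc df dg.
have dfg : differentiable (fun y => (f y, g y)) x by exact: differentiable_pair.
have db : differentiable (fun q => b q.1 q.2) (f x, g x).
  exact: differentiable_bilin.
split; first exact: (differentiable_comp dfg db).
by rewrite (diff_comp dfg db) diff_bilin // diff_pair.
Qed.

(** By the Leibniz rule a directional derivative is a sum of two terms of the same bilinear shape.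
    The induction applies to each, [CkW] lowering the order of the factor that is not
    differentiated. *)
Lemma Ck_bilin (R : realType) (V W1 W2 W : normedModType R) k (U : set V)
    (b : {bilinear W1 -> W2 -> W}) (f : V -> W1) (g : V -> W2) :
  open U -> continuous (fun q => b q.1 q.2) -> Ck k U f -> Ck k U g ->
  Ck k U (fun x => b (f x) (g x)).
Proof.
move=> Uo bc; elim: k f g => [f g fc gc x Ux|k IH f g Cf Cg].
  apply: (continuous_comp (f := fun y => (f y, g y)) (g := fun q => b q.1 q.2)).
    exact: cvg_pair (fc x Ux) (gc x Ux).
  exact: bc.
have [[df Df] [dg Dg]] := (Cf, Cg).
split=> [x Ux|v].
  exact: (proj1 (diff_bilin_comp bc (df x Ux) (dg x Ux))).
have IHfg := CkD Uo (IH _ _ (CkW Cf) (Dg v)) (IH _ _ (Df v) (CkW Cg)).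
apply: eq_Ck IHfg => // x Ux.
have [dfg dfgE] := diff_bilin_comp bc (df x Ux) (dg x Ux).
rewrite (deriveE v (df x Ux)) (deriveE v (dg x Ux)) (deriveE v dfg).
by rewrite dfgE.
Qed.

(** The derivative of a slice along [v] is the slice of the derivative along [(0, v)]. This extracts
    smoothness of one $F_\lambda$ from joint smoothness in $\lambda$ and the point. *)
Lemma Ck_slice (R : realType) (V1 V2 W : normedModType R) k (U : set (V1 * V2))
    (f : V1 * V2 -> W) (a : V1) :
  Ck k U f -> Ck k [set y | U (a, y)] (fun y => f (a, y)).
Proof.
elim: k f => [f fc y Uy|k IH f [df Df]].
  apply: (continuous_comp (f := fun y => (a, y)) (g := f)); last exact: fc.
  by apply: cvg_pair; [exact: cvg_cst | exact: cvg_id].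
split=> [y Uy|v].
  apply: (differentiable_comp (f := fun y => (a, y)) (g := f)); last exact: df.
  exact: differentiable_pair.
rewrite (_ : 'D_v _ = fun y => 'D_(0, v) f (a, y)); first exact: IH (Df _).
apply/funext => y; rewrite /derive; congr (lim _).
suff -> : (fun h : R => h^-1 *: (f (h *: (0, v) + (a, y)) - f (a, y))) =
  fun h : R => h^-1 *: (f (a, h *: v + y) - f (a, y)) by [].
apply/funext => h; congr (_ *: (f _ - _)).
by congr pair; rewrite /= scaler0 add0r.
Qed.

(** * Limits of matrices, entry by entry *)

Lemma cvg_mx (R : realType) (T : Type) (F : set_system T) {FF : Filter F} m n
    (f : T -> 'M[R]_(m, n)) (M : 'M[R]_(m, n)) :
  (forall i j, (fun x => f x i j) @ F --> M i j) -> f @ F --> M.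
Proof.
move=> h A [P MP sPA]; apply: (@filterS T F) => [x|].
  exact: (sPA (f x)).
(* There are finitely many entries, so their conditions hold simultaneously along the filter. *)
suff : \forall x \near F, forall ij : 'I_m * 'I_n, P ij.1 ij.2 (f x ij.1 ij.2).
  by apply: (@filterS T F) => x /= Px i j; exact: (Px (i, j)).
by apply: filter_forall => -[i j] /=; exact: (h i j) (MP i j).
Qed.

Lemma continuous_mulmx_pair (R : realType) m n p :
  continuous (fun q : 'M[R]_(m, n) * 'M[R]_(n, p) => q.1 *m q.2).
Proof.
move=> q; apply: cvg_mx => i j.
under eq_fun do rewrite mxE; rewrite mxE.
apply: cvg_big => // [|k _]; first exact: add_continuous.
apply: cvgM.
  exact: (continuous_comp (f := fst) (g := fun M : 'M[R]_(m, n) => M i k)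
           cvg_fst (@coord_continuous _ _ _ _ _ _)).
exact: (continuous_comp (f := snd) (g := fun M : 'M[R]_(n, p) => M k j)
           cvg_snd (@coord_continuous _ _ _ _ _ _)).
Qed.

(** * Explicit 2x2 matrices, the adjugate and $\exp(\theta e_3)$ *)

Lemma mx2P (R : realType) (X : 'M[R]_2) :
  X = mx2 (X ord0 ord0) (X ord0 ord_max) (X ord_max ord0) (X ord_max ord_max).
Proof.
apply/matrixP => i j; rewrite mxE.
by case: i => -[|[|//]] ?; case: j => -[|[|//]] ?; congr (X _ _); exact/val_inj.
Qed.

Lemma mulmx_mx2 (R : realType) (a b c d a' b' c' d' : R) :
  mx2 a b c d *m mx2 a' b' c' d' =
  mx2 (a * a' + b * c') (a * b' + b * d') (c * a' + d * c') (c * b' + d * d').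
Proof.
apply/matrixP => i j; rewrite !mxE !big_ord_recl big_ord0 !mxE addr0 /=.
by case: ifP; case: ifP.
Qed.

Lemma scale_mx2 (R : realType) (k a b c d : R) :
  k *: mx2 a b c d = mx2 (k * a) (k * b) (k * c) (k * d).
Proof. by apply/matrixP => i j; rewrite !mxE; do ! case: ifP. Qed.

Lemma opp_mx2 (R : realType) (a b c d : R) :
  - mx2 a b c d = mx2 (- a) (- b) (- c) (- d).
Proof. by apply/matrixP => i j; rewrite !mxE; do ! case: ifP. Qed.

Lemma add_mx2 (R : realType) (a b c d a' b' c' d' : R) :
  mx2 a b c d + mx2 a' b' c' d' = mx2 (a + a') (b + b') (c + c') (d + d').
Proof. by apply/matrixP => i j; rewrite !mxE; do ! case: ifP. Qed.

Lemma det_mx2 (R : realType) (a b c d : R) : \det (mx2 a b c d) = a * d - b * c.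
Proof.
rewrite (expand_det_row _ ord0) !big_ord_recl big_ord0 /cofactor !det_mx11.
rewrite !mxE /=; ring.
Qed.

Lemma scalar_mx2 (R : realType) (a : R) : a%:M = mx2 a 0 0 a.
Proof.
apply/matrixP => i j; rewrite !mxE.
by case: i => -[|[|//]] ?; case: j => -[|[|//]] ?.
Qed.

(* The adjugate of a 2x2 matrix, in a form that is visibly linear. *)
Definition adj2 (R : realType) (X : 'M[R]_2) : 'M[R]_2 := (\tr X)%:M - X.

Lemma adj2_mx2 (R : realType) (a b c d : R) :
  adj2 (mx2 a b c d) = mx2 d (- b) (- c) a.
Proof.
rewrite /adj2 scalar_mx2 opp_mx2 add_mx2 /mxtrace.
rewrite !big_ord_recl big_ord0 !mxE /=; congr mx2; ring.
Qed.

Lemma invmx_SL2 (R : realType) (X : 'M[R]_2) : SL2 X -> invmx X = adj2 X.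
Proof.
move=> detX.
have XX : X *m adj2 X = 1%:M.
  rewrite -detX scalar_mx2 [X]mx2P adj2_mx2 mulmx_mx2 det_mx2.
  congr mx2; ring.
by rewrite -[RHS]mul1mx -(mulVmx (proj1 (mulmx1_unit XX))) -mulmxA XX mulmx1.
Qed.

Lemma adj2M (R : realType) (X Y : 'M[R]_2) :
  adj2 (X *m Y) = adj2 Y *m adj2 X.
Proof.
rewrite [X]mx2P [Y]mx2P mulmx_mx2 !adj2_mx2 mulmx_mx2; congr mx2; ring.
Qed.

Lemma mform_isometry (R : realType) (F G X Y : 'M[R]_2) : SL2 F -> SL2 G ->
  mform (F *m X *m invmx G) (F *m Y *m invmx G) = mform X Y.
Proof.
move=> dF dG; rewrite /mform -mulmxDl -mulmxDr !det_mulmx det_inv.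
by rewrite dF dG invr1 !mul1r !mulr1.
Qed.

(** Powers of a diagonal matrix are diagonal, so the partial sums are those of two scalar
    exponential series. *)
Lemma mexp_e3 (R : realType) (theta : R) :
  mexp (theta *: e3) = mx2 (expR (- theta)) 0 0 (expR theta).
Proof.
have e3X k :
    (theta *: e3) ^+ k = mx2 ((- theta) ^+ k) 0 0 (theta ^+ k) :> 'M[R]_2.
  rewrite scale_mx2; elim: k => [|k IH]; first by rewrite !expr0 -scalar_mx2.
  rewrite exprS IH [LHS]mulmx_mx2 !exprS; congr mx2; ring.
apply: cvg_lim => //.
have sE n : series (fun k => (k`!%:R)^-1 *: (theta *: e3) ^+ k) n =
    mx2 (series (exp_coeff (- theta)) n) 0 0 (series (exp_coeff theta) n)
    :> 'M[R]_2.
  rewrite /series /=; elim: n => [|n IH].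
    by rewrite !big_geq //; apply/matrixP => i j; rewrite !mxE; do ! case: ifP.
  rewrite !big_nat_recr //= IH e3X scale_mx2 add_mx2 /exp_coeff /=.
  by congr mx2; ring.
rewrite (_ : series _ = fun n => mx2 (series (exp_coeff (- theta)) n) 0 0
    (series (exp_coeff theta) n)); last exact/funext.
apply: cvg_mx => i j; under eq_fun do rewrite mxE; rewrite mxE.
by do ! case: ifP => _; [exact: is_cvg_series_exp_coeff | exact: cvg_cst |
   exact: cvg_cst | exact: is_cvg_series_exp_coeff].
Qed.

(** * The adjugate as a continuous linear map *)

Lemma adj2_is_linear (R : realType) : linear (@adj2 R).
Proof.
move=> k X Y; rewrite [X]mx2P [Y]mx2P !(scale_mx2, add_mx2, adj2_mx2).
by congr mx2; ring.
Qed.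

HB.instance Definition _ (R : realType) :=
  GRing.isLinear.Build R 'M[R]_2 'M[R]_2 _ (@adj2 R) (@adj2_is_linear R).

Lemma adj2_continuous (R : realType) : continuous (@adj2 R).
Proof.
have adj2E : @adj2 R = fun Y => mx2 (Y ord_max ord_max) (- Y ord0 ord_max)
    (- Y ord_max ord0) (Y ord0 ord0).
  by apply/funext => Y; rewrite {1}[Y]mx2P adj2_mx2.
move=> X; apply: (@cvg_mx _ _ (nbhs X)) => i j; rewrite adj2E.
under eq_fun do rewrite mxE; rewrite mxE.
do ! case: ifP => _;
  by [exact: coord_continuous | apply: cvgN; exact: coord_continuous].
Qed.

Lemma mulmxl_continuous (R : realType) m n p (M : 'M[R]_(m, n)) :
  continuous (mulmx M : 'M[R]_(n, p) -> 'M[R]_(m, p)).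
Proof.
move=> X; apply: (@cvg_mx _ _ (nbhs X)) => i j.
under eq_fun do rewrite mxE; rewrite mxE.
apply: cvg_big => // [|k _]; first exact: add_continuous.
by apply: cvgM; [exact: cvg_cst | exact: coord_continuous].
Qed.

Lemma mulmx_adj2_continuous (R : realType) (M : 'M[R]_2) :
  continuous (mulmx M \o @adj2 R).
Proof.
move=> X; apply: continuous_comp; first exact: adj2_continuous.
exact: mulmxl_continuous.
Qed.

(** * The Maurer-Cartan form and the differential of $F_\lambda M F_1^{-1}$ *)

Definition mc_mx (R : realType) (A1 A2 A3 B1 B2 B3 : R * R -> R) (l : R)
    (p v : R * R) : 'M[R]_2 :=
  mx2 (- (v.1 * A3 p + v.2 * B3 p)) (v.1 * A2 p + v.2 * (l^-1 * B2 p))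
      (v.1 * (l * A1 p) + v.2 * B1 p) (v.1 * A3 p + v.2 * B3 p).

Section Frame.
Variables (R : realType) (Omega : set (R * R)) (Fhat : R -> R * R -> 'M[R]_2).
Variables A1 A2 A3 B1 B2 B3 : R * R -> R.
Hypothesis hO : open Omega.
Hypothesis hF : admissible_extended_frame Omega Fhat A1 A2 A3 B1 B2 B3.
Let alpha := mc_mx A1 A2 A3 B1 B2 B3.

Lemma frame_SL2 (l : R) (p : R * R) : l != 0 -> Omega p -> SL2 (Fhat l p).
Proof. by case: hF => h _ _ _ _; exact: h. Qed.

Lemma smooth_frame (l : R) : l != 0 -> smooth_on Omega (Fhat l).
Proof.
move=> l0 k; case: hF => _ /(_ k)/(@Ck_slice _ _ _ _ _ _ _ l) h _ _ _.
suff <- : [set y | l != 0 /\ Omega y] = Omega by [].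
by apply/seteqP; split=> y /=; [case | split].
Qed.

Lemma differentiable_frame (l : R) (p : R * R) :
  l != 0 -> Omega p -> differentiable (Fhat l) p.
Proof. by move=> l0 Op; case: (smooth_frame l0 1%N) => h _; exact: h. Qed.

Lemma diff_frame l p v : l != 0 -> Omega p ->
  ('d (Fhat l) p : R * R -> 'M[R]_2) v = Fhat l p *m alpha l p v.
Proof.
move=> l0 Op; case: hF => hSL _ _ _ /(_ l p v l0 Op) mc.
have -> : alpha l p v = maurer_cartan (Fhat l) p v.
  rewrite mc /alpha /mc_mx /xi1 /xi2 /e3 !(scale_mx2, add_mx2); congr mx2; ring.
have uF : Fhat l p \in unitmx by rewrite unitmxE (hSL l p l0 Op) unitr1.
by rewrite /maurer_cartan mulKVmx.
Qed.

(** [alpha l p v] has trace zero, so only $-X$ survives in $(\mathrm{tr} X) I - X$. *)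
Lemma adj2_alpha l p v : adj2 (alpha l p v) = - alpha l p v.
Proof.
rewrite /alpha /mc_mx adj2_mx2 opp_mx2; congr mx2; ring.
Qed.

Lemma frame_conjE l M p : Omega p ->
  Fhat l p *m (M *m adj2 (Fhat 1 p)) = Fhat l p *m M *m invmx (Fhat 1 p).
Proof.
by move=> Op; rewrite invmx_SL2 ?mulmxA //; apply: frame_SL2; rewrite ?oner_eq0.
Qed.

(** Taking for [M] the identity or [e3] covers both the surface and its normal. *)
Lemma smooth_frame_conj (l : R) M : l != 0 ->
  smooth_on Omega (fun q => Fhat l q *m M *m invmx (Fhat 1 q)).
Proof.
move=> l0 k; apply: eq_Ck (@frame_conjE l M) _ => //.
apply: (@Ck_bilin _ _ _ _ _ _ _ (@mulmx R 2 2 2)) => //.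
- exact: continuous_mulmx_pair.
- exact: smooth_frame.
apply: (@Ck_linear _ _ _ _ _ _ (mulmx M \o @adj2 R)) => //.
  exact: mulmx_adj2_continuous.
by apply: smooth_frame; rewrite oner_eq0.
Qed.

Lemma diff_frame_conj l M p v : l != 0 -> Omega p ->
  ('d (fun q => Fhat l q *m M *m invmx (Fhat 1 q)) p : R * R -> 'M[R]_2) v =
  Fhat l p *m (alpha l p v *m M - M *m alpha 1 p v) *m invmx (Fhat 1 p).
Proof.
move=> l0 Op; have n1 : (1 : R) != 0 by rewrite oner_eq0.
(* The inverse is replaced by the linear adjugate, which agrees with it only on [Omega]; near [p]
   this suffices for the differential. *)
have nE : \forall q \near p, Fhat l q *m (M *m adj2 (Fhat 1 q)) =
    Fhat l q *m M *m invmx (Fhat 1 q).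
  by apply: filterS (open_nbhs_nbhs (conj hO Op)) => q /frame_conjE.
pose L : {linear 'M[R]_2 -> 'M[R]_2} := mulmx M \o @adj2 R.
have Lc : continuous L by exact: mulmx_adj2_continuous.
have dL : differentiable L (Fhat 1 p) by exact: linear_differentiable.
have dF1 := differentiable_frame n1 Op.
(* This is $d(F_1^{-1}) = -\alpha_1 F_1^{-1}$: the adjugate reverses the product $F_1\alpha_1$ and
   negates $\alpha_1$. *)
have dLFE : ('d (L \o Fhat 1) p : R * R -> 'M[R]_2) v =
    - (M *m alpha 1 p v *m adj2 (Fhat 1 p)).
  rewrite (diff_comp dF1 dL) /= (diff_lin _ Lc) diff_frame //.
  by rewrite /L /= adj2M adj2_alpha mulNmx mulmxN mulmxA.
have [df /(congr1 (@^~ v)) /= dfE] := @diff_bilin_comp _ _ _ _ _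
  (@mulmx R 2 2 2) _ _ _ (@continuous_mulmx_pair R 2 2 2) (differentiable_frame l0 Op)
  (differentiable_comp dF1 dL).
have [_ /(congr1 (@^~ v)) /= ->] := near_eq_diff nE df.
apply: (etrans dfE); apply: (etrans (congr2 +%R
  (congr1 (mulmx (Fhat l p)) dLFE) (congr1 (mulmx^~ _) (diff_frame v l0 Op)))).
rewrite (invmx_SL2 (frame_SL2 n1 Op)).
by rewrite [LHS]addrC -[RHS]mulmxA mulmxBl [RHS]mulmxBr mulmxN !mulmxA.
Qed.

Variable mu : R.
Hypothesis mu0 : mu != 0.

Lemma frame_mapE :
  frame_map Fhat mu = fun q => Fhat mu q *m 1%:M *m invmx (Fhat 1 q).
Proof. by apply/funext => q; rewrite mulmx1. Qed.

Lemma diff_frame_map p v : Omega p ->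
  ('d (frame_map Fhat mu) p : R * R -> 'M[R]_2) v =
  Fhat mu p *m mx2 0 (v.2 * ((mu^-1 - 1) * B2 p)) (v.1 * ((mu - 1) * A1 p)) 0
    *m invmx (Fhat 1 p).
Proof.
move=> Op; rewrite frame_mapE diff_frame_conj // mulmx1 mul1mx.
congr (_ *m _ *m _); rewrite /alpha /mc_mx opp_mx2 add_mx2.
by rewrite invr1; congr mx2; ring.
Qed.

End Frame.

(** * The induced metric, the unit normal and the hyperbolic combination *)

Lemma mform_mx2 (R : realType) (a b c d a' b' c' d' : R) :
  mform (mx2 a b c d) (mx2 a' b' c' d') =
  (b * c' + b' * c - a * d' - a' * d) / 2.
Proof. by rewrite /mform add_mx2 !det_mx2; congr (_ / _); ring. Qed.

Theorem lemma5p6 (R : realType) (Omega : set (R * R))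
    (Fhat : R -> R * R -> 'M[R]_2) (A1 A2 A3 B1 B2 B3 : R * R -> R) (mu : R)
    (hOmega : planar_domain Omega)
    (hF : admissible_extended_frame Omega Fhat A1 A2 A3 B1 B2 B3)
    (hreg : regular_frame Omega A1 B2)
    (hmu0 : mu != 0) (hmu1 : mu != 1) :
  [/\ timelike_immersion Omega (frame_map Fhat mu),
      unit_normal Omega (frame_map Fhat mu) (frame_normal Fhat mu),
      forall p, Omega p ->
        frame_normal Fhat mu p = frame_map Fhat mu p *m Ad (Fhat 1 p) e3 &
      forall (theta : R) p, Omega p ->
        cosh theta *: frame_map Fhat mu p + sinh theta *: frame_normal Fhat mu p =
        Fhat mu p *m mexp (theta *: e3) *m invmx (Fhat 1 p)].
Proof.
have [hO _ _] := hOmega.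
have n1 : (1 : R) != 0 by rewrite oner_eq0.
have m1 : mu - 1 != 0 by rewrite subr_eq0.
have mV1 : mu^-1 - 1 != 0 by rewrite subr_eq0 invr_eq1.
have SLmu p : Omega p -> SL2 (Fhat mu p).
  by move=> Op; exact: (frame_SL2 hF hmu0 Op).
have SL1 p : Omega p -> SL2 (Fhat 1 p).
  by move=> Op; exact: (frame_SL2 hF n1 Op).
have uF p : Omega p -> Fhat 1 p \in unitmx.
  by move=> Op; rewrite unitmxE (SL1 p Op) unitr1.
have uFmu p : Omega p -> Fhat mu p \in unitmx.
  by move=> Op; rewrite unitmxE (SLmu p Op) unitr1.
split.
- split=> [|p Op]; first rewrite frame_mapE.
    exact: (smooth_frame_conj hO hF _ hmu0).
  have [A1n B2n] := hreg p Op.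
  (* The coefficients of $dx\,\xi_1$ and $dy\,\xi_2$ in $\alpha_\mu - \alpha_1$; regularity and $\mu
     \ne 1$ make them nonzero. *)
  set a := (mu - 1) * A1 p; set b := (mu^-1 - 1) * B2 p.
  have a0 : a != 0 by rewrite mulf_neq0.
  have b0 : b != 0 by rewrite mulf_neq0.
  have dfE v := diff_frame_map hO hF hmu0 v Op; rewrite -/a -/b in dfE.
  split.
  + rewrite /SL2 /= /frame_map det_mulmx det_inv (SLmu p Op) (SL1 p Op).
    by rewrite invr1 mulr1.
  (* Cancelling the invertible outer factors leaves the off-diagonal entries [v.1 * a] and
     [v.2 * b], which determine [v]. *)
  + move=> v w; rewrite !dfE => /(can_inj (mulmxKV (uF p Op))).
    move=> /(can_inj (mulKmx (uFmu p Op)))/matrixP vw.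
    have := vw ord0 ord_max; have := vw ord_max ord0; rewrite !mxE /=.
    move=> /(mulIf a0) + /(mulIf b0).
    by case: v {vw} => v1 v2; case: w => w1 w2 /= -> ->.
  + have gE v w : induced_metric (frame_map Fhat mu) p v w =
        a * b * (v.2 * w.1 + v.1 * w.2) / 2.
      rewrite /induced_metric !dfE mform_isometry; [|exact: SLmu|exact: SL1].
      by rewrite mform_mx2; congr (_ / _); ring.
    (* The metric is $ab\,dx\,dy$, so $(1,t)$ has square norm $abt$, and $t = \mp 1/(ab)$ gives $\mp
       1$. *)
    exists (1, - (a * b)^-1), (1, (a * b)^-1); rewrite !gE /=.
    by split; field; rewrite a0 b0.
- split=> [|p Op]; first exact: (smooth_frame_conj hO hF _ hmu0).
  have NE : frame_normal Fhat mu p = Fhat mu p *m e3 *m invmx (Fhat 1 p) by [].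
  split=> [|v|]; rewrite NE.
  + rewrite frame_mapE mform_isometry; [|exact: SLmu|exact: SL1].
    by rewrite scalar_mx2 mform_mx2; field.
  + rewrite (diff_frame_map hO hF hmu0 v Op) mform_isometry;
      [|exact: SLmu|exact: SL1].
    by rewrite mform_mx2; field.
  + rewrite mform_isometry; [|exact: SLmu|exact: SL1].
    by rewrite mform_mx2; field.
- by move=> p Op; rewrite /Ad /frame_normal /frame_map !mulmxA mulmxKV // uF.
- move=> theta p Op; rewrite frame_mapE /frame_normal.
  (* Both summands share the outer factors $F_\mu$ and $F_1^{-1}$; once these are pulled out, an
     identity of diagonal matrices remains. *)
  rewrite (scalemxAl (cosh theta)) (scalemxAl (sinh theta)) -mulmxDl.
  rewrite (scalemxAr (cosh theta)) (scalemxAr (sinh theta)) -mulmxDr.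
  congr (_ *m _ *m _); rewrite mexp_e3 scalar_mx2 !scale_mx2 add_mx2.
  by rewrite /cosh /sinh; congr mx2; field.
Qed.
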